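(* Let $A\in\mathbb{R}^{n_x\times n_x}$, $E\in\mathbb{R}^{n_x\times n_w}$, $\Sigma_w\in\mathbb{R}^{n_w\times n_w}$ with $\Sigma_w\succ 0$, and $\varepsilon\in(0,1)$. Consider the discrete-time linear stochastic system $x_{t+1}=Ax_t+Ew_t$, $t\in\mathbb{Z}_{\ge 0}$, and assume that $\|A\|<1$ and $(A,E)$ is reachable. Let $P\succ 0$ be the solution of the Lyapunov equation $APA^\top-P+E\Sigma_wE^\top=0$. For $r>0$ define $\mathcal{D}=\{x\in\mathbb{R}^{n_x}:\|x\|^2-r^2\le 0\}$. If $$r^2>\frac{1}{\varepsilon}\operatorname{Tr}(P),$$ then $\mathcal{D}$ is a worst-case CVaR ultimate bound for the system, i.e., for every initial state $x_0\in\mathbb{R}^{n_x}$ there exists $T=T(x_0)>0$ such that $$\sup_{\mathbb{P}\in\mathcal{P}_t}\mathbb{P}\text{-CVaR}_\varepsilon[\|x_t\|^2-r^2]\le 0\quad\text{for all } t\ge T.$$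
   Context: $\|\cdot\|$ is the Euclidean norm on vectors and the maximum singular value on matrices; $M\succ 0$ means positive definite. Reachability of $(A,E)$ means $\operatorname{rank}[E, AE,\dots,A^{n_x-1}E]=n_x$. CVaR: for a probability distribution $\mathbb{P}$ of a random vector $\xi$ and a measurable loss $L$, at level $\varepsilon\in(0,1)$, $\mathbb{P}\text{-CVaR}_\varepsilon[L(\xi)]=\inf_{\beta\in\mathbb{R}}\{\beta+\frac1\varepsilon\mathbb{E}_{\mathbb{P}}[(L(\xi)-\beta)^+]\}$, where $x^+=\max\{x,0\}$. The worst-case CVaR over a set of distributions is the supremum of CVaR over that set. Setting: $x_0$ is a given deterministic vector and the disturbances $w_t\in\mathbb{R}^{n_w}$ are i.i.d. with mean zero and covariance $\Sigma_w$, but their distribution is otherwise unknown. For $t\ge 1$ write $\bar w_t=[w_0^\top,\dots,w_{t-1}^\top]^\top\in\mathbb{R}^{n_wt}$; then $x_t=A^tx_0+\sum_{k=0}^{t-1}A^{t-1-k}Ew_k$ is a function of $x_0$ and $\bar w_t$. $\mathcal{P}_t$ is the set of all probability distributions of $\bar w_t$ on $\mathbb{R}^{n_wt}$ with mean zero and covariance $I_t\otimes\Sigma_w$. Definition: for $f:\mathbb{R}^{n_x}\to\mathbb{R}$, the set $\{x: f(x)\le 0\}$ is a worst-case CVaR ultimate bound for the system if for every $x_0$ there is $T=T(x_0)>0$ with $\sup_{\mathbb{P}\in\mathcal{P}_t}\mathbb{P}\text{-CVaR}_\varepsilon[f(x_t)]\le 0$ for all $t\ge T$; here $f(x)=\|x\|^2-r^2$.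 *)

(* Defs.v *)
From HB Require Import structures.
From mathcomp Require Import all_boot all_order all_algebra.
From mathcomp Require Import mxtens.
From mathcomp Require Import all_classical all_reals all_analysis.

Set Implicit Arguments.
Unset Strict Implicit.
Unset Printing Implicit Defensive.

Import Order.TTheory GRing.Theory Num.Theory.
Local Open Scope classical_set_scope.
Local Open Scope ring_scope.

(* The library norm on matrices is the max norm, so the Euclidean vector norm
   and the spectral matrix norm are defined here. *)
Definition enorm (R : realType) (n : nat) (x : 'cV[R]_n) : R :=
  Num.sqrt (\sum_(i < n) x i 0 ^+ 2).

Definition singular_values (R : realType) (m n : nat) (A : 'M[R]_(m, n)) :
    set R :=
  [set s | 0 <= s /\ eigenvalue (A^T *m A) (s ^+ 2)].

(* The set of singular values is finite, so its supremum is its maximum;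
   the supremum is 0 when n = 0 and the set is empty. *)
Definition specnorm (R : realType) (m n : nat) (A : 'M[R]_(m, n)) : R :=
  sup (singular_values A).

Definition posdef (R : realType) (n : nat) (M : 'M[R]_n) : Prop :=
  M^T = M /\ forall x : 'cV[R]_n, x != 0 -> 0 < (x^T *m M *m x) 0 0.

Definition reachable (R : realType) (nx nw : nat) (A : 'M[R]_nx)
    (E : 'M[R]_(nx, nw)) : Prop :=
  \rank (\mxrow_(k < nx) (A ^+ k *m E)) = nx.

Definition cvar (R : realType) (d : measure_display) (T : measurableType d)
    (eps : R) (L : T -> R) (P : probability T R) : \bar R :=
  ereal_inf [set (beta%:E
      + (1 / eps)%:E * 'E_P[(fun xi => Num.max (L xi - beta) 0)%R])%E
    | beta in [set: R]].

Definition worst_case_cvar (R : realType) (d : measure_display)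
    (T : measurableType d) (eps : R) (L : T -> R)
    (Ps : set (probability T R)) : \bar R :=
  ereal_sup [set cvar eps L P | P in Ps].

(* R^(t * nw) is represented by tuples, which carry the product (that is,
   Borel) sigma-algebra. Stacking w_0, ..., w_(t-1) puts the j-th coordinate of
   w_k at position k * nw + j, which is also the index convention of the
   Kronecker product *t. Square integrability is part of having a covariance
   matrix. *)
Definition ambiguity_set (R : realType) (nw : nat) (Sigma : 'M[R]_nw)
    (t : nat) : set (probability ((t * nw).-tuple R) R) :=
  [set P : probability ((t * nw).-tuple R) R |
    [/\ forall i, (fun w => tnth w i) \in Lfun P 2%:E,
        forall i, ('E_P[fun w => tnth w i] = 0)%E
      & forall i j, covariance P (fun w => tnth w i) (fun w => tnth w j)
                    = (((1%:M : 'M[R]_t) *t Sigma) i j)%:E]].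
Arguments ambiguity_set {R nw} Sigma t.

Fixpoint state (R : realType) (nx nw : nat) (A : 'M[R]_nx)
    (E : 'M[R]_(nx, nw)) (x0 : 'cV[R]_nx) (w : nat -> 'cV[R]_nw) (t : nat) :
    'cV[R]_nx :=
  if t is s.+1 then A *m state A E x0 w s + E *m w s else x0.

(* w_k for k < t, extended by 0 to k >= t. *)
Definition unstack (R : realType) (nw t : nat) (wbar : (t * nw).-tuple R)
    (k : nat) : 'cV[R]_nw :=
  \col_(j < nw) nth 0 wbar (k * nw + j).

Definition stacked_state (R : realType) (nx nw : nat) (A : 'M[R]_nx)
    (E : 'M[R]_(nx, nw)) (x0 : 'cV[R]_nx) (t : nat)
    (wbar : (t * nw).-tuple R) : 'cV[R]_nx :=
  state A E x0 (unstack wbar) t.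

Lemma unstackE (R : realType) (nw t : nat) (wbar : (t * nw).-tuple R)
    (k : 'I_t) (j : 'I_nw) :
  unstack wbar k j 0 = tnth wbar (mxtens_index (k, j)).
Proof. by rewrite mxE (tnth_nth 0). Qed.

Lemma stateE (R : realType) (nx nw : nat) (A : 'M[R]_nx)
    (E : 'M[R]_(nx, nw)) (x0 : 'cV[R]_nx) (w : nat -> 'cV[R]_nw) (t : nat) :
  state A E x0 w t =
  A ^+ t *m x0 + \sum_(k < t) A ^+ (t - 1 - k) *m E *m w k.
Proof.
elim: t => [|t IHt] /=; first by rewrite big_ord0 addr0 expr0 mul1mx.
rewrite IHt mulmxDr mulmxA -addrA exprS; congr (_ + _).
rewrite big_ord_recr /= subSS subn0 subnn expr0 mul1mx; congr (_ + _).
rewrite mulmx_sumr; apply: eq_bigr => k _.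
have -> : (t - k = (t - 1 - k).+1)%N by rewrite -subnDA add1n subnSK.
by rewrite exprS !mulmxA.
Qed.

(* The property depends on f, not only on the set {x | f x <= 0}. *)
Definition worst_case_cvar_ultimate_bound (R : realType) (nx nw : nat)
    (A : 'M[R]_nx) (E : 'M[R]_(nx, nw)) (Sigma : 'M[R]_nw) (eps : R)
    (f : 'cV[R]_nx -> R) : Prop :=
  forall x0 : 'cV[R]_nx, exists T : nat, (0 < T)%N /\
    forall t : nat, (T <= t)%N ->
      (worst_case_cvar eps (fun wbar => f (stacked_state A E x0 wbar))
         (ambiguity_set Sigma t) <= 0)%E.

(* Main.v *)
Require Import Defs.
From HB Require Import structures.
From mathcomp Require Import all_boot all_order all_algebra.
From mathcomp Require Import mxtens.
From mathcomp Require Import all_classical all_reals all_analysis.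
From mathcomp Require Import ring lra.

Import Order.TTheory GRing.Theory Num.Theory.
Import numFieldNormedType.Exports.
Local Open Scope classical_set_scope.
Local Open Scope ring_scope.

(** Taking [beta = - r ^+ 2] in the infimum bounds the CVaR by
    [E |x_t|^2 / eps - r^2].  The second moment depends only on the first two
    moments of the disturbances: since [P = Q_t + A^t P (A^t)^T], where [Q_t] is
    the covariance of [x_t], it is [|A^t x_0|^2 + tr P - tr (A^t P (A^t)^T)],
    hence at most [|A^t x_0|^2 + tr P], and [A^t x_0] tends to [0].  The last
    point needs [|A x|^2 <= c |x|^2] with [c < 1], where [c] is the maximum of
    the Rayleigh quotient of [A^T A] and the maximiser is an eigenvector. *)

Lemma enorm_sqrE (R : realType) (n : nat) (x : 'cV[R]_n) :
  enorm x ^+ 2 = \sum_i x i 0 ^+ 2.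
Proof. by rewrite sqr_sqrtr// sumr_ge0// => i _; exact: sqr_ge0. Qed.

(** * Means of affine and quadratic functions of random variables *)

Section second_moments.
Context {d : measure_display} {T : measurableType d} {R : realType}.
Variable P : probability T R.

(** Integrability is kept together with the value because additivity of the expectation requires
    it. *)
Definition has_mean (X : T -> R) (m : R) : Prop :=
  X \in Lfun P 1%:E /\ ('E_P[X] = m%:E)%E.

Lemma has_mean_cst (c : R) : has_mean (cst c) c.
Proof. by split; [exact: Lfun_cst | exact: expectation_cst]. Qed.

Lemma has_meanD (X Y : T -> R) (a b : R) :
  has_mean X a -> has_mean Y b -> has_mean (fun x => X x + Y x) (a + b).
Proof.
move=> [iX eX] [iY eY]; split; first exact: rpredD.
by rewrite EFinD -eX -eY -expectationD.
Qed.

Lemma has_meanZ (c : R) (X : T -> R) (a : R) :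
  has_mean X a -> has_mean (fun x => c * X x) (c * a).
Proof.
move=> [iX eX].
have -> : (fun x => c * X x) = (c \o* X)%R.
  by apply/funext => x /=; rewrite mulrC.
by split; [exact: Lfun_scale | rewrite expectationZl// eX EFinM].
Qed.

Lemma has_mean_sum (I : Type) (s : seq I) (X : I -> T -> R) (m : I -> R) :
  (forall i, has_mean (X i) (m i)) ->
  has_mean (fun x => \sum_(i <- s) X i x) (\sum_(i <- s) m i).
Proof.
move=> Xm; elim: s => [|i s IHs].
  rewrite big_nil (_ : (fun=> _) = cst 0); first exact: has_mean_cst.
  by apply/funext => x; rewrite big_nil.
rewrite big_cons (_ : (fun=> _) = (fun x => X i x + \sum_(j <- s) X j x)).
  exact: has_meanD.
by apply/funext => x; rewrite big_cons.
Qed.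

Lemma has_mean_affine_sqr (I : finType) (Y : I -> T -> R) (S : I -> I -> R)
    (a : R) (g : I -> R) :
  (forall i, has_mean (Y i) 0) ->
  (forall i j, has_mean (fun x => Y i x * Y j x) (S i j)) ->
  has_mean (fun x => (a + \sum_i g i * Y i x) ^+ 2)
    (a ^+ 2 + \sum_i \sum_j g i * g j * S i j).
Proof.
move=> mY cY.
have -> : (fun x => (a + \sum_i g i * Y i x) ^+ 2) =
    (fun x => (a ^+ 2 + 2 * a * (\sum_i g i * Y i x)) +
      \sum_i \sum_j g i * g j * (Y i x * Y j x)).
  apply/funext => x; rewrite sqrrD; congr (_ + _); first by ring.
  rewrite expr2 mulr_suml; apply: eq_bigr => i _; rewrite mulr_sumr.
  by apply: eq_bigr => j _; rewrite mulrACA.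
(* The vanishing mean of the cross term is put back, so that the value splits like the expanded
   square. *)
have -> : a ^+ 2 + \sum_i \sum_j g i * g j * S i j =
    (a ^+ 2 + 2 * a * \sum_i g i * 0) + \sum_i \sum_j g i * g j * S i j.
  by rewrite [X in _ + _ * X]big1 ?mulr0 ?addr0// => i _; rewrite mulr0.
apply: has_meanD; last first.
  by apply: has_mean_sum => i; apply: has_mean_sum => j; exact: has_meanZ.
apply: has_meanD; first exact: has_mean_cst.
by apply: has_meanZ; apply: has_mean_sum => i; exact: has_meanZ.
Qed.

Lemma has_mean_affine_enorm_sqr {n m : nat} {Y : 'I_m -> T -> R} {S : 'M[R]_m}
    (a : 'cV[R]_n) (G : 'M[R]_(n, m)) :
  (forall i, has_mean (Y i) 0) ->
  (forall i j, has_mean (fun x => Y i x * Y j x) (S i j)) ->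
  has_mean (fun x => enorm (a + G *m \col_i Y i x) ^+ 2)
    (enorm a ^+ 2 + \tr (G *m S *m G^T)).
Proof.
move=> mY cY.
have -> : (fun x => enorm (a + G *m \col_i Y i x) ^+ 2) =
    (fun x => \sum_i (a i 0 + \sum_j G i j * Y j x) ^+ 2).
  apply/funext => x; rewrite enorm_sqrE; apply: eq_bigr => i _.
  rewrite !mxE; congr ((_ + _) ^+ 2).
  by apply: eq_bigr => j _; rewrite mxE.
rewrite enorm_sqrE /mxtrace -big_split /=.
apply: has_mean_sum => i.
rewrite (_ : (_ *m _) i i = \sum_j \sum_k G i j * G i k * S j k); last first.
  rewrite exchange_big mxE; apply: eq_bigr => k _.
  rewrite !mxE mulr_suml; apply: eq_bigr => j _; ring.
exact: has_mean_affine_sqr.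
Qed.

End second_moments.

(** * Stacked disturbances and the covariance of the state *)

Section block_row.
Context {R : realType}.

(* The blocks H 0, ..., H (t - 1) side by side, with columns ordered by
   [mxtens_index] as in the Kronecker product. *)
Definition block_row {m n t : nat} (H : 'I_t -> 'M[R]_(m, n)) :
    'M[R]_(m, t * n) :=
  \matrix_(i, p) H (mxtens_unindex p).1 i (mxtens_unindex p).2.

Lemma sum_mxtens_index (t n : nat) (F : 'I_(t * n) -> R) :
  \sum_p F p = \sum_k \sum_j F (mxtens_index (k, j)).
Proof.
rewrite pair_big /= (reindex (@mxtens_index t n)) /=; last first.
  exists (@mxtens_unindex t n) => p _.
    exact: mxtens_indexK.
  exact: mxtens_unindexK.
by apply: eq_bigr => -[].
Qed.

Lemma mul_block_row_tr (m n p t : nat) (H : 'I_t -> 'M[R]_(m, n))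
    (K : 'I_t -> 'M[R]_(p, n)) :
  block_row H *m (block_row K)^T = \sum_k H k *m (K k)^T.
Proof.
apply/matrixP => i j; rewrite summxE mxE sum_mxtens_index.
apply: eq_bigr => k _; rewrite mxE; apply: eq_bigr => l _.
by rewrite !mxE mxtens_indexK.
Qed.

(** The Kronecker product is block diagonal with [t] copies of [S], so it acts on each block
    separately. *)
Lemma mul_block_row_tens (m n t : nat) (H : 'I_t -> 'M[R]_(m, n))
    (S : 'M[R]_n) :
  block_row H *m ((1%:M : 'M[R]_t) *t S) = block_row (fun k => H k *m S).
Proof.
apply/matrixP => i q; case: (mxtens_indexP q) => k j.
rewrite [LHS]mxE [RHS]mxE sum_mxtens_index mxtens_indexK /=.
rewrite (bigD1 k)//= [X in _ + X]big1; last first.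
  move=> h /negPf hk; rewrite big1// => l _.
  by rewrite tensmxE !mxE hk mul0r mulr0.
rewrite addr0 mxE; apply: eq_bigr => l _.
by rewrite tensmxE !mxE mxtens_indexK eqxx mul1r.
Qed.

End block_row.

(** With [Q = P - A *m P *m A^T] the sum telescopes, once its order is reversed so that the exponent
    is [k]. *)
Lemma Lyapunov_iter {R : realType} {n : nat} {A P Q : 'M[R]_n} (t : nat) :
  A *m P *m A^T - P + Q = 0 ->
  \sum_(k < t) A ^+ (t - 1 - k) *m Q *m (A ^+ (t - 1 - k))^T =
  P - A ^+ t *m P *m (A ^+ t)^T.
Proof.
move=> hL; have -> : Q = P - A *m P *m A^T.
  by apply/eqP; rewrite -subr_eq0 opprB addrC hL.
rewrite (reindex_inj rev_ord_inj) /=.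
under eq_bigr => k _.
  have -> : (t - 1 - (t - k.+1) = k)%N.
    by rewrite -subnDA add1n subnSK ?subKn ?(ltnW (ltn_ord k)).
  over.
elim: t => [|t IHt]; first by rewrite big_ord0 expr0 trmx1 mulmx1 mul1mx subrr.
rewrite big_ord_recr /= IHt mulmxBr mulmxBl addrA subrK; congr (_ - _).
by rewrite exprSr trmx_mul !mulmxA.
Qed.

Lemma stacked_state_block_row (R : realType) (nx nw t : nat) (A : 'M[R]_nx)
    (E : 'M[R]_(nx, nw)) (x0 : 'cV[R]_nx) (w : (t * nw).-tuple R) :
  stacked_state A E x0 w = A ^+ t *m x0 +
    block_row (fun k : 'I_t => A ^+ (t - 1 - k) *m E) *m \col_i tnth w i.
Proof.
rewrite /stacked_state stateE; congr (_ + _).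
(* The stacked disturbance is itself a transposed block row, so the product becomes a sum over
   times. *)
have -> : \col_i tnth w i = (block_row (fun k : 'I_t => (unstack w k)^T))^T.
  apply/matrixP => p j; case: (mxtens_indexP p) => k l.
  by rewrite [LHS]mxE -unstackE !mxE mxtens_indexK.
by rewrite mul_block_row_tr; apply: eq_bigr => k _; rewrite trmxK.
Qed.

(** * Maximal Rayleigh quotient and contraction in the Euclidean norm *)

Section Rayleigh.
Context {R : realType}.

Lemma scalemx00 (a : R) (M : 'M[R]_1) : (a *: M) 0 0 = a * M 0 0.
Proof. by rewrite mxE. Qed.

Lemma tr_row_sqr (n : nat) (u : 'rV[R]_n) :
  (u *m u^T) 0 0 = \sum_i u 0 i ^+ 2.
Proof. by rewrite mxE; apply: eq_bigr => i _; rewrite mxE expr2. Qed.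

Lemma row_sqr_ge0 {n : nat} (u : 'rV[R]_n) : 0 <= (u *m u^T) 0 0.
Proof. by rewrite tr_row_sqr sumr_ge0// => i _; exact: sqr_ge0. Qed.

Lemma row_sqr_eq0 (n : nat) (u : 'rV[R]_n) : ((u *m u^T) 0 0 == 0) = (u == 0).
Proof.
rewrite tr_row_sqr psumr_eq0; last by move=> i _; exact: sqr_ge0.
apply/allP/eqP => [u0|-> i _]; last by rewrite mxE expr0n eqxx.
apply/rowP => i; rewrite mxE; apply/eqP.
by have := u0 i (mem_index_enum i); rewrite sqrf_eq0.
Qed.

Lemma continuous_quadratic_form (n : nat) (M : 'M[R]_n) :
  continuous (fun u : 'rV[R]_n => (u *m M *m u^T) 0 0).
Proof.
have -> : (fun u : 'rV[R]_n => (u *m M *m u^T) 0 0) =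
    (fun u : 'rV[R]_n => \sum_j (\sum_i u 0 i * M i j) * u 0 j).
  by apply/funext => u; rewrite mxE; apply: eq_bigr => j _; rewrite !mxE.
apply: continuous_big => [|j _]; first exact: add_continuous.
move=> u; apply: continuousM; last exact: coord_continuous.
move: u; apply: continuous_big => [|i _]; first exact: add_continuous.
move=> u; apply: continuousM; last exact: cst_continuous.
exact: coord_continuous.
Qed.

Lemma compact_sphere (n : nat) :
  compact [set u : 'rV[R]_n | (u *m u^T) 0 0 = 1].
Proof.
have Kc := @rV_compact R n _ (fun=> @segment_compact R (-1) 1).
apply: subclosed_compact Kc _.
  have -> : [set u : 'rV[R]_n | (u *m u^T) 0 0 = 1] =
      (fun u : 'rV[R]_n => (u *m 1%:M *m u^T) 0 0) @^-1` [set 1].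
    by apply/seteqP; split=> u /=; rewrite mulmx1.
  apply: preimage_closed; last exact: closed_eq.
  by move=> u _; exact: continuous_quadratic_form.
move=> u /=; rewrite tr_row_sqr => u1 i.
have : u 0 i ^+ 2 <= 1.
  by rewrite -u1 (bigD1 i)//= lerDl sumr_ge0// => j _; exact: sqr_ge0.
rewrite /= in_itv/= -ler_norml -(@expr_le1 _ 2 `|u 0 i|)//.
by rewrite real_normK ?num_real.
Qed.

(** An isotropic [v] minimises the form, so the first variation vanishes in every direction; the
    direction [u = v *m B] has variation [2 * b], with [b] the squared norm of [v *m B]. *)
Lemma psd_isotropic_kernel (n : nat) (B : 'M[R]_n) (v : 'rV[R]_n) :
  B^T = B -> (forall u : 'rV[R]_n, 0 <= (u *m B *m u^T) 0 0) ->
  (v *m B *m v^T) 0 0 = 0 -> v *m B = 0.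
Proof.
move=> Bsym Bpsd v0; apply/eqP; rewrite -row_sqr_eq0 trmx_mul Bsym mulmxA.
set u := v *m B; set b := (u *m B *m v^T) 0 0.
have bE : b = (v *m B *m u^T) 0 0.
  by rewrite /b /u trmx_mul Bsym !mulmxA.
have b0 : 0 <= b by rewrite bE row_sqr_ge0.
set q := (u *m B *m u^T) 0 0; have q0 : 0 <= q := Bpsd u.
(* The nonnegative form along the line [v + s u] is [2 s b + s^2 q]; a small
   negative [s] makes it negative unless [b = 0]. *)
have /(_ (- (b / (q + 1)))) : forall s, 0 <= 2 * s * b + s ^+ 2 * q.
  move=> s; have := Bpsd (v + s *: u).
  rewrite linearD linearZ /= !mulmxDl !mulmxDr -!scalemxAl -!scalemxAr.
  have addE (M N : 'M[R]_1) : (M + N) 0 0 = M 0 0 + N 0 0 by rewrite mxE.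
  rewrite !(addE, scalemx00) v0 -/b -bE -/q.
  by rewrite (_ : _ + _ = 2 * s * b + s ^+ 2 * q)//; ring.
move=> h; rewrite eq_le b0 andbT leNgt; apply/negP => bgt0.
(* The denominator [q + 1] is positive even when [q = 0]. *)
have : 2 * - (b / (q + 1)) * b + (- (b / (q + 1))) ^+ 2 * q =
    - (b / (q + 1)) ^+ 2 * (q + 2).
  by field; rewrite gt_eqF// ltr_wpDl.
move=> e; move: h; rewrite e mulNr oppr_ge0 leNgt mulr_gt0 ?ltr_wpDl//.
by rewrite exprn_gt0// divr_gt0// ltr_wpDl.
Qed.

(** At a maximiser [v] on the compact unit sphere, with maximum [c], the form of [c%:M - M] is
    nonnegative and vanishes at [v], which puts [v] in its kernel. Size [n.+1] makes the sphere
    nonempty. *)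
Lemma symmetric_max_eigenvalue {n : nat} {M : 'M[R]_n.+1} : M^T = M ->
  exists2 c, eigenvalue M c &
    forall u : 'rV[R]_n.+1, (u *m M *m u^T) 0 0 <= c * (u *m u^T) 0 0.
Proof.
move=> Msym; set S := [set u : 'rV[R]_n.+1 | (u *m u^T) 0 0 = 1].
have S0 : S !=set0.
  by exists (delta_mx 0 0); rewrite /S /= trmx_delta mul_delta_mx mxE eqxx.
have [|v /= vS vmax] := EVT_max_rV S0 (@compact_sphere n.+1)
    (f := fun u => (u *m M *m u^T) 0 0).
  by apply: continuous_subspaceT; exact: continuous_quadratic_form.
move: vS; rewrite inE /S /= => v1.
set c := (v *m M *m v^T) 0 0 in vmax.
have hc (u : 'rV[R]_n.+1) : (u *m M *m u^T) 0 0 <= c * (u *m u^T) 0 0.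
  have [->|u0] := eqVneq u 0; first by rewrite !mul0mx !mxE mulr0.
  have n0 : 0 < (u *m u^T) 0 0 by rewrite lt_def row_sqr_eq0 u0 row_sqr_ge0.
  (* Homogeneity carries the bound from the unit vector [s^-1 *: u] to [u]. *)
  set s := Num.sqrt ((u *m u^T) 0 0).
  have s0 : s ^+ 2 = (u *m u^T) 0 0 by rewrite sqr_sqrtr// ltW.
  have := vmax (s^-1 *: u).
  rewrite inE /S /= linearZ /= -!scalemxAl -!scalemxAr !scalerA.
  rewrite !scalemx00 -invfM -expr2 s0 mulVf ?gt_eqF//.
  by move=> /(_ erefl); rewrite mulrC ler_pdivrMr.
exists c => //; apply/eigenvalueP; exists v; last first.
  by rewrite -row_sqr_eq0 v1 oner_neq0.
apply/eqP; rewrite eq_sym -mul_mx_scalar -subr_eq0 -mulmxBr; apply/eqP.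
have formE (u : 'rV[R]_n.+1) : (u *m (c%:M - M) *m u^T) 0 0 =
    c * (u *m u^T) 0 0 - (u *m M *m u^T) 0 0.
  rewrite mulmxBr mulmxBl mul_mx_scalar -scalemxAl.
  by rewrite [LHS]mxE; congr (_ + _); rewrite mxE.
apply: psd_isotropic_kernel.
- by rewrite linearB /= tr_scalar_mx Msym.
- by move=> u; rewrite formE subr_ge0.
- by rewrite formE v1 mulr1 subrr.
Qed.

End Rayleigh.

Lemma enorm_sqr_tr (R : realType) (n : nat) (x : 'cV[R]_n) :
  enorm x ^+ 2 = (x^T *m x^T^T) 0 0.
Proof.
by rewrite tr_row_sqr enorm_sqrE; apply: eq_bigr => i _; rewrite mxE.
Qed.

Lemma enorm_mul_contraction {R : realType} {n : nat} {A : 'M[R]_n} :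
  specnorm A < 1 ->
  exists2 c : R, 0 <= c < 1 &
    forall x : 'cV[R]_n, enorm (A *m x) ^+ 2 <= c * enorm x ^+ 2.
Proof.
case: n A => [|n] A hA.
  (* In dimension zero there is no eigenvector, but every norm is zero. *)
  exists 0; first by rewrite lexx ltr01.
  by move=> x; rewrite !enorm_sqr_tr !tr_row_sqr !big_ord0 mulr0.
have Msym : (A^T *m A)^T = A^T *m A by rewrite trmx_mul trmxK.
have [c ceig cmax] := symmetric_max_eigenvalue Msym.
have formE (u : 'rV[R]_n.+1) :
    (u *m (A^T *m A) *m u^T) 0 0 = ((u *m A^T) *m (u *m A^T)^T) 0 0.
  by rewrite trmx_mul trmxK !mulmxA.
have sub_c a : eigenvalue (A^T *m A) a -> 0 <= a <= c.
  move=> /eigenvalueP[v vM v0].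
  have n0 : 0 < (v *m v^T) 0 0 by rewrite lt_def row_sqr_eq0 v0 row_sqr_ge0.
  have := cmax v; have := row_sqr_ge0 (v *m A^T).
  rewrite -formE vM -scalemxAl scalemx00.
  by rewrite pmulr_lge0// ler_pM2r// => -> ->.
have /andP[c0 _] := sub_c _ ceig.
exists c; last first.
  by move=> x; rewrite !enorm_sqr_tr trmx_mul -formE.
(* Since [Num.sqrt c] is a singular value, it is at most [specnorm A]. The supremum is a genuine one
   because [sub_c] bounds all singular values by [Num.sqrt c]. *)
rewrite c0 /= -(sqr_sqrtr c0) expr_lt1// ?sqrtr_ge0//.
apply: le_lt_trans hA; apply: ub_le_sup; last first.
  by split; [exact: sqrtr_ge0 | rewrite sqr_sqrtr].
exists (Num.sqrt c) => s [s0 /sub_c /andP[_ sc]].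
by rewrite -(ger0_norm s0) -sqrtr_sqr ler_wsqrtr.
Qed.

(** * CVaR bound and second moment of the state *)

Lemma cvar_sub_cst_le {R : realType} {d : measure_display}
    {T : measurableType d} (eps : R) {L : T -> R} {P : probability T R}
    (a : R) {m : R} :
  (forall x, 0 <= L x) -> has_mean P L m ->
  (cvar eps (fun x => L x - a)%R P <= (- a + 1 / eps * m)%:E)%E.
Proof.
(* With [beta = - a] the excess is [L x] itself, and the positive part leaves it unchanged. *)
move=> L0 [_ Lm]; apply: ereal_inf_lbound; exists (- a) => //=.
rewrite EFinD (EFinM _ m) -Lm; congr (_ + _ * expectation P _)%E.
by apply/funext => x; rewrite opprK subrK max_l.
Qed.

Lemma has_mean_stacked_state {R : realType} {nx nw : nat} {A : 'M[R]_nx}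
    {E : 'M[R]_(nx, nw)} {Sigma : 'M[R]_nw} {P : 'M[R]_nx} (x0 : 'cV[R]_nx)
    {t : nat} {Q : probability ((t * nw).-tuple R) R} :
  A *m P *m A^T - P + E *m Sigma *m E^T = 0 -> ambiguity_set Sigma t Q ->
  has_mean Q (fun w => enorm (stacked_state A E x0 w) ^+ 2)
    (enorm (A ^+ t *m x0) ^+ 2 + \tr (P - A ^+ t *m P *m (A ^+ t)^T)).
Proof.
move=> hL [L2 m0 cov].
have Qfin : Q setT \is a fin_num by rewrite probability_setT.
have L1 i : (fun w : (t * nw).-tuple R => tnth w i) \in Lfun Q 1.
  exact: Lfun_subset12.
have mY i : has_mean Q (fun w => tnth w i) 0 by split.
have cY i j : has_mean Q (fun w => tnth w i * tnth w j)
    (((1%:M : 'M[R]_t) *t Sigma) i j).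
  have L12 := Lfun2_mul_Lfun1 (L2 i) (L2 j).
  (* For zero means the covariance is the mean of the product. *)
  split=> //; rewrite -cov covarianceE// (m0 i) mul0e sube0; congr expectation.
have := has_mean_affine_enorm_sqr Q (A ^+ t *m x0)
  (block_row (fun k : 'I_t => A ^+ (t - 1 - k) *m E)) mY cY.
rewrite mul_block_row_tens mul_block_row_tr -(Lyapunov_iter t hL).
have -> : \sum_(k < t) A ^+ (t - 1 - k) *m E *m Sigma *m
      (A ^+ (t - 1 - k) *m E)^T =
    \sum_(k < t) A ^+ (t - 1 - k) *m (E *m Sigma *m E^T) *m
      (A ^+ (t - 1 - k))^T.
  by apply: eq_bigr => k _; rewrite trmx_mul !mulmxA.
by congr has_mean; apply/funext => w; rewrite stacked_state_block_row.
Qed.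

Lemma posdef_trace_ge0 {R : realType} {n : nat} (A : 'M[R]_n) {P : 'M[R]_n} :
  posdef P -> 0 <= \tr (A *m P *m A^T).
Proof.
move=> [_ P0]; apply: sumr_ge0 => i _.
(* Each diagonal entry is the form of [P] at a row of [A]; a zero row is treated apart, as [posdef]
   concerns nonzero vectors. *)
have -> : (A *m P *m A^T) i i = (((row i A)^T)^T *m P *m (row i A)^T) 0 0.
  rewrite trmxK -row_mul tr_row mxE [RHS]mxE.
  by apply: eq_bigr => k _; rewrite !mxE.
have [->|/P0/ltW//] := eqVneq (row i A)^T 0.
by rewrite mulmx0 mxE.
Qed.

Theorem mainTheorem1 (R : realType) (nx nw : nat) (A : 'M[R]_nx)
    (E : 'M[R]_(nx, nw)) (Sigma_w : 'M[R]_nw) (eps : R) (P : 'M[R]_nx) (r : R)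
    (hSigma : posdef Sigma_w) (heps : 0 < eps < 1)
    (hA : specnorm A < 1) (hAE : reachable A E)
    (hP : posdef P) (hLyap : A *m P *m A^T - P + E *m Sigma_w *m E^T = 0)
    (hr : 0 < r) (hrP : 1 / eps * \tr P < r ^+ 2) :
  worst_case_cvar_ultimate_bound A E Sigma_w eps
    (fun x => enorm x ^+ 2 - r ^+ 2).
Proof.
move=> x0; have /andP[eps0 _] := heps.
have [c /andP[c0 c1] Ac] := enorm_mul_contraction hA.
have Act t : enorm (A ^+ t *m x0) ^+ 2 <= enorm x0 ^+ 2 * c ^+ t.
  elim: t => [|t IHt]; first by rewrite expr0 mul1mx mulr1.
  rewrite (exprS A) -mulmxA (le_trans (Ac _))// (exprS c).
  by rewrite [leRHS]mulrCA ler_wpM2l.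
(* This slack must absorb the transient [enorm (A ^+ t *m x0) ^+ 2], which the geometric bound [Act]
   makes small. *)
have gap : 0 < eps * r ^+ 2 - \tr P.
  by rewrite subr_gt0 mulrC -ltr_pdivrMr// mulrC -div1r.
have c1' : `|c| < 1 by rewrite ger0_norm.
have /cvgr_lt/(_ _ gap) [N _ hN] := cvg_geometric (enorm x0 ^+ 2) c1'.
(* [N] depends only on [x0] and the data, not on the distribution [Q]; the successor makes the time
   positive. *)
exists N.+1; split=> // t Nt; apply: ge_ereal_sup => _ [Q hQ <-].
have hm := has_mean_stacked_state x0 hLyap hQ.
apply: (le_trans (cvar_sub_cst_le _ _ _ hm)).
  by move=> w; exact: sqr_ge0.
(* After multiplication by [eps], the trace of [A ^+ t *m P *m (A ^+ t)^T] is dropped by its sign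
   and the transient is below the slack. *)
rewrite lee_fin addrC subr_le0 div1r mulrC ler_pdivrMr// mulrC.
have := hN t (ltnW Nt); have := Act t.
have := posdef_trace_ge0 (A ^+ t) hP.
rewrite /geometric /= linearB /=; lra.
Qed.
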